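(* Let $\mathcal{R},\mathcal{S}$ be TRSs over $\mathcal{F}$ such that $\mathcal{R}\cup\mathcal{S}$ is linear and $\mathcal{R}$ is non-collapsing, and let $L\subseteq\mathcal{T}(\mathcal{F})$ be a set of ground terms. If $\mathcal{R}/\mathcal{S}$ is match-RT-bounded for $L$, then $\to_{\mathcal{R}/\mathcal{S}}$ is terminating on $L$ and $\mathrm{cp}(n,\to_{\mathcal{R}/\mathcal{S}},L)=O(n)$.
   Context: $\to_{\mathcal{R}/\mathcal{S}}=\to_{\mathcal{S}}^*\cdot\to_{\mathcal{R}}\cdot\to_{\mathcal{S}}^*$; $\mathrm{cp}(n,\to,L)=\sup\{\mathrm{dl}(t,\to)\mid t\in L,|t|\le n\}$ with $\mathrm{dl}(t,\to)=\sup\{m\mid\exists u,\ t\to^mu\}$. A TRS is collapsing if it has a rule whose right-hand side is a variable. For $N\subseteq\mathbb{N}$, $\mathcal{F}_N$ is the signature of symbols $f_c$ ($f\in\mathcal{F}$, $c\in N$) with the arity of $f$; $\mathrm{lift}_c(f)=f_c$, $\mathrm{base}(f_c)=f$, $\mathrm{height}(f_c)=c$, extended to terms, sets and TRSs. $\mathrm{FPos}(t)$: positions of function symbols; $\|t\|$: number of function symbol occurrences. $\mathrm{match}(\mathcal{R})$: all rules $l'\to\mathrm{lift}_c(r)$ with $l\to r\in\mathcal{R}$, $\mathrm{base}(l')=l$, $c=1+\min\{\mathrm{height}(l'(p))\mid p\in\mathrm{FPos}(l)\}$. For $c\in\mathbb{N}$, $\mathrm{MATCHRT}^c(\mathcal{S})$: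 all rules $l'\to\mathrm{lift}_d(r)$ with $\mathrm{base}(l')\to r\in\mathcal{S}$ and $d=\min\{c,\mathrm{height}(l'(\epsilon))\}$ if $\|\mathrm{base}(l')\|\ge\|r\|$ and $\mathrm{lift}_{\mathrm{height}(l'(\epsilon))}(\mathrm{base}(l'))=l'$, and $d=\min(\{c\}\cup\{1+\mathrm{height}(l'(p))\mid p\in\mathrm{FPos}(l')\})$ otherwise. $\mathrm{matchRT}(\mathcal{R}/\mathcal{S},c)$ is the relative TRS $\mathrm{match}(\mathcal{R})/\mathrm{MATCHRT}^c(\mathcal{S})$. For a relation $\to$ and set of ground terms $K$, $\mathrm{Succ}_{\to}(K)=\{t\text{ ground}\mid s\to^*t,\ s\in K\}$. $\mathcal{R}/\mathcal{S}$ is match-RT-bounded for $L$ if there is $c\in\mathbb{N}$ such that every function symbol in every term of $\mathrm{Succ}_{\to_{\mathrm{matchRT}(\mathcal{R}/\mathcal{S},c)}}(\mathrm{lift}_0(L))$ has height at most $c$.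
   Formalization: The TRSs R and S are assumed finite (the usual convention); for infinite systems the claim fails, e.g. R={f(x)→g(x)}, S={a→f^k(b) | k≥2}, L={a} is match-RT-bounded with c=2 but a has derivations of unbounded length. *)

(* Defs.v *)
From mathcomp Require Import all_boot all_order all_algebra.
From mathcomp Require Import all_classical constructive_ereal.
From Stdlib Require Import Relation_Operators.

Set Implicit Arguments.
Unset Strict Implicit.
Unset Printing Implicit Defensive.

Local Open Scope classical_set_scope.

(** * First-order terms *)

Record signature := Signature { symbol :> Type; arity : symbol -> nat }.

(* Variables are taken from the countably infinite set nat.  The arguments of
   a symbol are an 'I_(arity f)-indexed family, so every term is well-formed;
   Leibniz equality of terms is the intended one by function extensionality. *)
Inductive term (F : signature) : Type :=
| Var of nat
| Fun (f : F) of ('I_(arity f) -> term F).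
Arguments Var {F} _.
Arguments Fun {F} f _.

Section Terms.
Variable F : signature.
Implicit Types (s t u l r : term F) (p : seq nat).

Definition is_var t : bool := if t is Var _ then true else false.

(* Variable occurrences, from left to right, with repetitions. *)
Fixpoint vars t : seq nat :=
  match t with
  | Var x => [:: x]
  | Fun f a => flatten [seq vars (a i) | i <- enum 'I_(arity f)]
  end.

Definition ground t : Prop := vars t = [::].

Definition linear_term t : bool := uniq (vars t).

(* |t|: number of occurrences of variables and function symbols. *)
Fixpoint tsize t : nat :=
  match t with
  | Var _ => 1
  | Fun f a => (\sum_(i < arity f) tsize (a i)).+1
  end.

(* ||t||: number of occurrences of function symbols only. *)
Fixpoint fsize t : nat :=
  match t with
  | Var _ => 0
  | Fun f a => (\sum_(i < arity f) fsize (a i)).+1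
  end.

(* t(p): the function symbol at position p, or None if p is not a position of
   t or is a variable position.  Arguments are numbered from 0. *)
Fixpoint symb_at t p : option F :=
  match t, p with
  | Var _, _ => None
  | Fun f a, [::] => Some f
  | Fun f a, i :: q =>
      if insub i is Some j then symb_at (a j) q else None
  end.

Definition FPos t : set (seq nat) := [set p | isSome (symb_at t p)].

Fixpoint subst (sigma : nat -> term F) t : term F :=
  match t with
  | Var x => sigma x
  | Fun f a => Fun f (fun i => subst sigma (a i))
  end.

(** * Rewriting *)

(* A rule l -> r is the pair (l, r).  Sets of rules may be infinite: this is
   needed for the systems over the lifted signature below. *)
Definition trs := set (term F * term F).

Definition is_trs (R : trs) : Prop :=
  forall l r, R (l, r) -> ~~ is_var l /\ {subset vars r <= vars l}.

Definition linear_trs (R : trs) : Prop :=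
  forall l r, R (l, r) -> linear_term l /\ linear_term r.

Definition collapsing (R : trs) : Prop := exists l x, R (l, Var x).

Inductive rewrite (R : trs) : term F -> term F -> Prop :=
| rewrite_root l r sigma of R (l, r) :
    rewrite R (subst sigma l) (subst sigma r)
| rewrite_arg (f : F) (a b : 'I_(arity f) -> term F) (i : 'I_(arity f))
    of rewrite R (a i) (b i) & (forall j, j != i -> a j = b j) :
    rewrite R (Fun f a) (Fun f b).

Definition rel_rewrite (R S : trs) (s t : term F) : Prop :=
  exists s' t', [/\ clos_refl_trans _ (rewrite S) s s',
                    rewrite R s' t' & clos_refl_trans _ (rewrite S) t' t].

End Terms.

(** * Termination and complexity *)

Fixpoint rel_pow (T : Type) (rel : T -> T -> Prop) (m : nat) (t u : T) : Prop :=
  if m is k.+1 then exists2 v, rel t v & rel_pow rel k v u else t = u.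

Definition terminating_on (T : Type) (rel : T -> T -> Prop) (L : set T) : Prop :=
  forall t, L t ->
  ~ exists f : nat -> T, f 0 = t /\ forall i, rel (f i) (f i.+1).

(* Suprema of sets of natural numbers, in N together with +oo, are computed in
   the extended integers; the supremum of the empty set is 0. *)
Definition dl (T : Type) (t : T) (rel : T -> T -> Prop) : \bar int :=
  supremum 0%:E%E
    [set (Posz m)%:E%E | m in [set m | exists u, rel_pow rel m t u]].

Definition cp (F : signature) (n : nat) (rel : term F -> term F -> Prop)
    (L : set (term F)) : \bar int :=
  supremum 0%:E%E [set dl t rel | t in [set t | L t /\ tsize t <= n]].

Definition linearly_bounded (f : nat -> \bar int) : Prop :=
  exists C N : nat, forall n, N <= n -> (f n <= (Posz (C * n))%:E)%E.

(** * Height-labelled terms *)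

(* F_N: the symbol f_c is the pair (f, c). *)
Definition lifted (F : signature) : signature :=
  @Signature (F * nat) (fun g => arity g.1).

Section Lifted.
Variable F : signature.

Definition height (g : lifted F) : nat := g.2.

Fixpoint lift (c : nat) (t : term F) : term (lifted F) :=
  match t with
  | Var x => Var x
  | Fun f a => @Fun (lifted F) (f, c) (fun i => lift c (a i))
  end.

Fixpoint base (t : term (lifted F)) : term F :=
  match t with
  | Var x => Var x
  | Fun g a => @Fun F g.1 (fun i => base (a i))
  end.

Definition heights (t : term (lifted F)) : set nat :=
  [set h | exists2 p, FPos t p & omap height (symb_at t p) = Some h].

Definition is_min (A : set nat) (m : nat) : Prop :=
  A m /\ forall k, A k -> m <= k.

Definition match_trs (R : trs F) : trs (lifted F) :=
  [set rho | exists l' l r m,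
     [/\ rho = (l', lift m.+1 r), R (l, r), base l' = l
       & is_min [set h | exists2 p, FPos l p
                         & omap height (symb_at l' p) = Some h] m]].

Definition MATCHRT (c : nat) (S : trs F) : trs (lifted F) :=
  [set rho | exists l' r g d,
     [/\ rho = (l', lift d r), S (base l', r), symb_at l' [::] = Some g
       & let keep := fsize r <= fsize (base l') /\
                     lift (height g) (base l') = l' in
         (keep -> d = minn c (height g)) /\
         (~ keep -> is_min ([set c] `|` [set h.+1 | h in heights l']) d)]].

Definition Succ (rel : term (lifted F) -> term (lifted F) -> Prop)
    (K : set (term (lifted F))) : set (term (lifted F)) :=
  [set t | ground t /\ exists2 s, K s & clos_refl_trans _ rel s t].

Definition matchRT (R S : trs F) (c : nat) :
    term (lifted F) -> term (lifted F) -> Prop :=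
  rel_rewrite (match_trs R) (MATCHRT c S).

Definition matchRT_bounded (R S : trs F) (L : set (term F)) : Prop :=
  exists c : nat,
  forall t, Succ (matchRT R S c) [set lift 0 s | s in L] t ->
  forall p g, symb_at t p = Some g -> height g <= c.

End Lifted.

(* Main.v *)
(* By left-linearity every R/S-derivation from a ground term t lifts to a
   matchRT-derivation from lift_0(t), whose heights stay at most c by
   boundedness.  A symbol of height h weighs v(c - h), where v(0) = 0 and
   v(k + 1) = 1 + B v(k) for a bound B on the sizes of the right-hand sides.
   By right-linearity the substituted subterms do not gain weight.  A lifted
   R-rule, and an S-rule that raises a height below c, replaces a symbol of
   height h < c by at most B symbols of height h + 1, and so loses weight; the
   remaining S-rules do not gain any.  Hence a derivation from t has at most
   |t| v(c) R-steps. *)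

Require Import Defs.
From mathcomp Require Import all_boot all_order all_algebra.
From mathcomp Require Import all_classical constructive_ereal.
From Stdlib Require Import Relation_Operators Eqdep.

(* Again, as MathComp has its own [Fun], [lift] and [tsize]. *)
Import Defs.

Local Open Scope classical_set_scope.

Set Implicit Arguments.
Unset Strict Implicit.

(** * Preliminaries on sequences, suprema and iterated relations *)

Lemma uniq_flatten_map (I A : eqType) (v : I -> seq A) (s : seq I) :
  uniq (flatten [seq v i | i <- s]) ->
  {in s, forall i, uniq (v i)} /\
  {in s &, forall i j x, x \in v i -> x \in v j -> i = j}.
Proof.
elim: s => [|k s IHs] //=; rewrite cat_uniq => /and3P[uk /hasPn disj /IHs[us inj]].
have sep i x : i \in s -> x \in v i -> x \notin v k.
  by move=> si xi; apply: disj; apply/flatten_mapP; exists i.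
split=> [i|i j]; rewrite !inE; first by case/predU1P=> [->|/us].
case/predU1P=> [->|si] /predU1P[->|sj] // x xi xj; last exact: inj xj.
- by move: (sep j x sj xj); rewrite xi.
- by move: (sep i x si xi); rewrite xj.
Qed.

(** Used with the variables of a right-hand side as [s1] and those of its left-hand side as [s2]:
    this is where right-linearity enters. *)
Lemma leq_sum_uniq_sub (A : eqType) (w : A -> nat) (s1 s2 : seq A) :
  uniq s1 -> {subset s1 <= s2} ->
  \sum_(x <- s1) w x <= \sum_(x <- s2) w x.
Proof.
move=> us1 sub; apply: (sub_le_big_seq leqnn (fun m n => leq_addr n m)) => x.
rewrite count_uniq_mem //; case: (boolP (x \in s1)) => // /sub.
by rewrite -has_pred1 has_count.
Qed.

Lemma finite_set_bounded (T : Type) (f : T -> nat) (A : set T) :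
  finite_set A -> exists B, forall x, A x -> f x <= B.
Proof.
move=> /(finite_image f)/finite_seqP[s fA]; exists (\max_(n <- s) n) => x Ax.
have fx : f x \in s by have : (f @` A) (f x) by [exists x]; rewrite fA.
by rewrite (big_rem _ fx) leq_maxl.
Qed.

(** [supremum] returns [x0] when [A] is empty or has no least upper bound, hence the premise on
    [x0]. *)
Lemma supremum_le (d : Order.disp_t) (T : porderType d) (x0 y : T) (A : set T) :
  (x0 <= y)%O -> ubound A y -> (supremum x0 A <= y)%O.
Proof.
move=> x0y Ay; rewrite /supremum; case: ifP => // _.
by case: xgetP => // z _ [_]; apply.
Qed.

Lemma rel_pow_prefix (T : Type) (rel : T -> T -> Prop) (f : nat -> T) (m : nat) :
  (forall i, rel (f i) (f i.+1)) -> exists u, rel_pow rel m (f 0) u.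
Proof.
elim: m f => [|m IHm] f frel; first by exists (f 0).
have [u fu] := IHm (fun i => f i.+1) (fun i => frel i.+1).
by exists u; exists (f 1).
Qed.

(** * Variables and groundness under substitution and rewriting *)

Section Terms.
Variable F : signature.
Implicit Types (s t l r : term F) (R : trs F).

Lemma Fun_inj (f : F) (a b : 'I_(arity f) -> term F) :
  Fun f a = Fun f b -> a = b.
Proof. by move=> [=] e; apply: inj_pair2 e. Qed.

Lemma vars_subst (sigma : nat -> term F) t :
  vars (subst sigma t) = flatten [seq vars (sigma x) | x <- vars t].
Proof.
elim: t => [x|f a IHa] /=; first by rewrite cats0.
elim: (enum _) => //= i s ->.
by rewrite map_cat flatten_cat IHa.
Qed.

Lemma eq_subst_vars (sigma tau : nat -> term F) t :
  {in vars t, sigma =1 tau} -> subst sigma t = subst tau t.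
Proof.
elim: t => [x|f a IHa] /= eqst; first by rewrite eqst ?inE.
congr (Fun f _); apply/funext => i; apply: IHa => x xi; apply: eqst.
by apply/flatten_mapP; exists i; rewrite ?mem_enum.
Qed.

Lemma symb_at_subst (sigma : nat -> term F) t p f :
  symb_at t p = Some f -> symb_at (subst sigma t) p = Some f.
Proof. by elim: t p => [x|g a IHa] [|i p] //=; case: insub => // j; apply: IHa. Qed.

Lemma fsize_le_tsize t : fsize t <= tsize t.
Proof. by elim: t => //= f a IHa; rewrite ltnS; apply: leq_sum. Qed.

Lemma rewrite_vars R s t :
  (forall l r, R (l, r) -> {subset vars r <= vars l}) ->
  rewrite R s t -> {subset vars t <= vars s}.
Proof.
move=> subR; elim=> [l r sigma lr|f a b i _ IHi ab] x /=.
  rewrite !vars_subst => /flatten_mapP[y yr xy].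
  by apply/flatten_mapP; exists y => //; apply: subR yr.
move=> /flatten_mapP[j jf xj]; apply/flatten_mapP; exists j => //.
by have [ji|/ab->//] := eqVneq j i; move: xj; rewrite ji; apply: IHi.
Qed.

Lemma ground_rewrite R s t :
  is_trs R -> rewrite R s t -> ground s -> ground t.
Proof.
move=> trsR /rewrite_vars sub gs.
have {}sub := sub (fun l r lr => (trsR l r lr).2).
by rewrite /ground; case: (vars t) sub => // x v /(_ x); rewrite gs inE eqxx => /(_ isT).
Qed.

Lemma ground_rewrites R s t :
  is_trs R -> clos_refl_trans _ (rewrite R) s t -> ground s -> ground t.
Proof.
by move=> trsR; elim=> [? ? /ground_rewrite|//|? ? ? _ IH1 _ IH2 /IH1/IH2]; apply.
Qed.

End Terms.

(** * Additive weights of terms and their change in a rewrite step *)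

Section Weight.
Variables (F : signature) (w : F -> nat).
Implicit Types (s t l r : term F) (R : trs F).

Fixpoint weight t : nat :=
  match t with
  | Var _ => 0
  | Fun f a => w f + \sum_(i < arity f) weight (a i)
  end.

Lemma weight_subst (sigma : nat -> term F) t :
  weight (subst sigma t) = weight t + \sum_(x <- vars t) weight (sigma x).
Proof.
elim: t => [x|f a IHa] /=; first by rewrite big_seq1.
rewrite big_flatten big_map big_enum -addnA -big_split /=.
by congr (_ + _); apply: eq_bigr.
Qed.

Lemma weight_symb_at t p f : symb_at t p = Some f -> w f <= weight t.
Proof.
elim: t p => [x|g a IHa] [|i p] //=; first by case=> <-; rewrite leq_addr.
case: insub => // j /IHa wj; rewrite (bigD1 j) //=.
by apply: (leq_trans wj); rewrite addnCA leq_addr.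
Qed.

(** The context is common to both sides, and [r] receives each substituted term at most once, [l] at
    least as often. The bound is additive to avoid truncated subtraction. The symbols of [r] are
    traced into [t] so that a height bound on [t] limits the height the step creates. *)
Lemma rewrite_weight R s t :
  (forall l r, R (l, r) -> uniq (vars r) /\ {subset vars r <= vars l}) ->
  rewrite R s t -> exists l r,
    [/\ R (l, r),
        forall p f, symb_at r p = Some f -> exists q, symb_at t q = Some f
      & weight t + weight l <= weight s + weight r].
Proof.
move=> varR; elim=> [l r sigma lr|f a b i _ [l [r [lr symr wlr]]] ab].
  exists l, r; split=> // [p f rp|]; first by exists p; apply: symb_at_subst.
  have [ur sub] := varR l r lr; rewrite !weight_subst addnAC [X in _ <= X]addnAC.
  by rewrite [weight l + _]addnC leq_add2l leq_sum_uniq_sub.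
exists l, r; split=> // [p g /symr[q bq]|].
  by exists (val i :: q) => /=; rewrite valK.
rewrite /= (bigD1 i) //= [X in _ <= _ + X + _](bigD1 i) //=.
rewrite [X in _ <= _ + (_ + X) + _](eq_bigr (fun j => weight (b j))) => [|j /ab->//].
by rewrite -!addnA leq_add2l ![_ + (\sum_(j < _ | _) _ + _)]addnCA !leq_add2l.
Qed.

End Weight.

(** * Lifting rewrite steps to height-labelled terms *)

Section Lifted.
Variable F : signature.
Implicit Types (t r : term F) (s u : term (lifted F)).

Lemma vars_base u : vars (base u) = vars u.
Proof.
elim: u => //= g a IHa; congr flatten.
by apply: eq_map => i; apply: IHa.
Qed.

Lemma liftK c : cancel (@lift F c) (@base F).
Proof.
by elim=> //= f a IHa; congr (Fun f _); apply/funext => i; apply: IHa.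
Qed.

Lemma vars_lift c t : vars (lift c t) = vars t.
Proof. by rewrite -vars_base liftK. Qed.

Lemma base_subst (sigma : nat -> term (lifted F)) u :
  base (subst sigma u) = subst (fun x => base (sigma x)) (base u).
Proof.
by elim: u => //= g a IHa; congr (Fun _ _); apply/funext => i; apply: IHa.
Qed.

Lemma weight_lift (w : lifted F -> nat) (v : nat -> nat) c t :
  (forall g, w g = v (height g)) -> weight w (lift c t) = fsize t * v c.
Proof.
move=> wv; elim: t => //= f a IHa; rewrite mulSn wv big_distrl /=.
by congr (_ + _); apply: eq_bigr.
Qed.

Lemma base_Fun u (f : F) (a : 'I_(arity f) -> term F) :
  base u = Fun f a ->
  exists c (b : 'I_(arity f) -> term (lifted F)),
    u = @Fun (lifted F) (f, c) b /\ forall i, base (b i) = a i.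
Proof.
case: u => [|[g c] b] //= e; have fg : g = f by case: e.
subst g; exists c, b; split=> // i.
by rewrite -(Fun_inj e).
Qed.

(** By linearity the arguments of [t] share no variables, so the labelled substitutions found for
    them can be glued. A repeated variable could meet two labellings of the same term. *)
Lemma base_eq_subst t (sigma : nat -> term F) u :
  linear_term t -> base u = subst sigma t ->
  exists l tau, [/\ u = subst tau l, base l = t
                  & forall x, base (tau x) = sigma x].
Proof.
elim: t u => [x|f a IHa] u /= lint.
  move=> ux; exists (Var x), (fun y => if y == x then u else lift 0 (sigma y)).
  (* Off [x] only the base of the substitution is prescribed, so label 0 will do. *)
  by split=> //= [|y]; rewrite ?eqxx //; case: eqP => [->|_] //; rewrite liftK.
move=> /base_Fun[c [b [-> ba]]].
have [lin disj] := uniq_flatten_map lint.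
have /fin_all_exists[l] i : exists l, exists tau,
    [/\ b i = subst tau l, base l = a i & forall x, base (tau x) = sigma x].
  by apply: IHa; rewrite // /linear_term lin ?mem_enum.
move=> /fin_all_exists[tau lP].
(* At most one argument contains [x]; variables outside the term get label 0. *)
pose mu x := if [pick i | x \in vars (a i)] is Some i then tau i x
             else lift 0 (sigma x).
exists (@Fun (lifted F) (f, c) l), mu; split=> [||x] /=.
- congr (@Fun (lifted F) _ _); apply/funext => i; have [-> li _] := lP i.
  apply: eq_subst_vars => x; rewrite -vars_base li /mu => xi.
  case: pickP => [j xj|/(_ i)]; last by rewrite xi.
  by rewrite (disj i j _ _ x) ?mem_enum.
- by congr (Fun f _); apply/funext => i; have [] := lP i.
- by rewrite /mu; case: pickP => [i _|_]; [have [] := lP i | rewrite liftK].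
Qed.

(** The labels in a redex are arbitrary, so [R'] must cover every labelling of a left-hand side;
    which [d] it assigns is immaterial, since [base] erases it. *)
Lemma rewrite_lifting (R : trs F) (R' : trs (lifted F)) u t :
  (forall l r, R (l, r) -> linear_term l) ->
  (forall l' r, R (base l', r) -> exists d, R' (l', lift d r)) ->
  rewrite R (base u) t -> exists2 u', rewrite R' u u' & base u' = t.
Proof.
move=> linR liftR; move e: (base u) => s st.
elim: st u e => {s t} [l r sigma lr|f a b i _ IHi ab] u.
  move=> /(base_eq_subst (linR _ _ lr))[l' [tau [-> bl bt]]].
  rewrite -bl in lr; have [d lr'] := liftR _ _ lr.
  exists (subst tau (lift d r)); first exact: rewrite_root.
  by rewrite base_subst liftK; congr subst; apply/funext.
move=> /base_Fun[c [a' [-> aa]]]; have [u' au bu] := IHi _ (aa i).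
exists (@Fun (lifted F) (f, c) (fun j => if j == i then u' else a' j)).
  by apply: (@rewrite_arg (lifted F) R' (f, c) _ _ i) => [|j /negPf->]; rewrite ?eqxx.
congr (Fun f _); apply/funext => j.
by case: eqVneq => [->|/ab<-].
Qed.

Lemma rewrites_lifting (R : trs F) (R' : trs (lifted F)) u t :
  (forall l r, R (l, r) -> linear_term l) ->
  (forall l' r, R (base l', r) -> exists d, R' (l', lift d r)) ->
  clos_refl_trans _ (rewrite R) (base u) t ->
  exists2 u', clos_refl_trans _ (rewrite R') u u' & base u' = t.
Proof.
move=> linR liftR; move e: (base u) => s st.
elim: st u e => {s t} [s t st|s|s1 s2 s3 _ IH1 _ IH2] u e.
- rewrite -e in st; have [u' uu' bu] := rewrite_lifting linR liftR st.
  by exists u' => //; apply: rt_step.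
- by exists u => //; apply: rt_refl.
- have [u1 uu1 e1] := IH1 _ e; have [u2 uu2 e2] := IH2 _ e1.
  by exists u2 => //; apply: rt_trans uu1 uu2.
Qed.

Lemma ex_is_min (A : set nat) : A !=set0 -> exists m, is_min A m.
Proof.
case=> n An; have ex : exists n, `[<A n>] by exists n; apply/asboolP.
by case: (ex_minnP ex) => m /asboolP Am min; exists m; split=> // k /asboolP/min.
Qed.

(** A left-hand side is not a variable, so the height of its root makes the set to be minimised
    nonempty. *)
Lemma match_lifting (R : trs F) u r :
  is_trs R -> R (base u, r) -> exists d, match_trs R (u, lift d r).
Proof.
move=> trsR ur; have [nv _] := trsR _ _ ur.
have [|m minm] := @ex_is_min [set h | exists2 p, FPos (base u) p
                                   & omap (@height F) (symb_at u p) = Some h].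
  by case: u nv {ur} => // g a _; exists (height g), [::].
by exists m.+1, u, (base u), r, m.
Qed.

Lemma MATCHRT_lifting (S : trs F) c u r :
  is_trs S -> S (base u, r) -> exists d, MATCHRT c S (u, lift d r).
Proof.
move=> trsS ur; have [nv _] := trsS _ _ ur.
have [g ug] : exists g, symb_at u [::] = Some g by case: u nv {ur} => // g a _; exists g.
have [keep|nkeep] := pselect (fsize r <= fsize (base u) /\
                              lift (height g) (base u) = u).
  by exists (minn c (height g)), u, r, g, (minn c (height g)); split.
have [|d mind] := @ex_is_min ([set c] `|` [set h.+1 | h in heights u]).
  by exists c; left.
by exists d, u, r, g, d; split.
Qed.

End Lifted.

(** * Weight loss along derivations whose heights are bounded by [c] *)

Section Bounded.
Variables (F : signature) (R S : trs F) (c B : nat).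
Hypotheses (trsR : is_trs R) (trsS : is_trs S).
Hypotheses (linR : linear_trs R) (linS : linear_trs S) (ncR : ~ collapsing R).
Hypothesis boundR : forall l r, R (l, r) -> fsize r <= B.
Hypothesis boundS : forall l r, S (l, r) -> fsize r <= B.

(* Solves [v (k + 1) = 1 + B v k]: one symbol outweighs any right-hand side
   whose symbols are one level higher.  Symbols of height at least [c] have
   weight 0, so the rules of [MATCHRT c S] may create them freely. *)
Definition height_weight (h : nat) : nat := iter (c - h) (fun k => (B * k).+1) 0.

Let W := weight (fun g : lifted F => height_weight (height g)).

Lemma height_weight_lt h : h < c -> B * height_weight h.+1 < height_weight h.
Proof. by move=> hc; rewrite /height_weight -(subnSK hc). Qed.

Lemma height_weight0 h : c <= h -> height_weight h = 0.
Proof. by rewrite /height_weight -subn_eq0 => /eqP->. Qed.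

Lemma W_lift d r : W (lift d r) = fsize r * height_weight d.
Proof. exact: weight_lift. Qed.

Lemma W_height u p h :
  omap (@height F) (symb_at u p) = Some h -> height_weight h <= W u.
Proof.
case e: (symb_at u p) => [g|] //= -[<-].
exact: (weight_symb_at (fun g => height_weight (height g)) e).
Qed.

(** The single symbol at [p] already outweighs the at most [B] symbols of the lifted right-hand
    side. *)
Lemma W_succ l r h p : fsize r <= B -> h < c ->
  omap (@height F) (symb_at l p) = Some h -> W (lift h.+1 r) < W l.
Proof.
move=> rB hc /W_height; apply: leq_trans; rewrite W_lift.
by apply: leq_ltn_trans (height_weight_lt hc); rewrite leq_mul2r rB orbT.
Qed.

Lemma MATCHRT_W l r : MATCHRT c S (l, r) -> W r <= W l.
Proof.
move=> [l' [r' [g [d [[-> ->] lr lg /= [keep nkeep]]]]]].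
have [[sz lk]|/nkeep[]] := pselect (fsize r' <= fsize (base l') /\
                                    lift (height g) (base l') = l').
  rewrite W_lift -lk W_lift keep // leq_mul //.
  (* Capping at [c] can change the height only where both weights are 0. *)
  by have [cg|//] := leqP c (height g); rewrite !height_weight0.
(* The new height is either [c], of weight 0, or one more than some height [h] in [l']. *)
move=> + _; case=> [->|[h [p _ lp] <-]]; first by rewrite W_lift height_weight0 ?muln0.
have [ch|hc] := leqP c h; first by rewrite W_lift height_weight0 ?muln0 // ltnW.
by apply: ltnW; apply: W_succ lp => //; apply: boundS lr.
Qed.

Lemma MATCHRT_vars l r : MATCHRT c S (l, r) ->
  uniq (vars r) /\ {subset vars r <= vars l}.
Proof.
move=> [l' [r' [g [d [[-> ->] lr _ _]]]]]; rewrite vars_lift -(vars_base l').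
by split; [case: (linS lr) | case: (trsS lr)].
Qed.

Lemma match_vars l r : match_trs R (l, r) ->
  uniq (vars r) /\ {subset vars r <= vars l}.
Proof.
move=> [l' [l0 [r' [m [[-> ->] lr bl _]]]]]; rewrite vars_lift -(vars_base l') bl.
by split; [case: (linR lr) | case: (trsR lr)].
Qed.

Lemma rewrites_MATCHRT_W s t :
  clos_refl_trans _ (rewrite (MATCHRT c S)) s t -> W t <= W s.
Proof.
elim=> {s t} [s t|//|s1 s2 s3 _ le1 _ le2]; last exact: leq_trans le2 le1.
move=> /(rewrite_weight (fun g : lifted F => height_weight (height g)) MATCHRT_vars).
case=> l [r [/MATCHRT_W le _ wlr]].
by rewrite -(leq_add2r (W l)); apply: (leq_trans wlr); rewrite leq_add2l.
Qed.

(* Since [R] is non-collapsing, the height created by the step occurs in [t],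
   so it is at most [c] and the redex contained a symbol of positive weight. *)
Lemma rewrite_match_W s t :
  (forall p g, symb_at t p = Some g -> height g <= c) ->
  rewrite (match_trs R) s t -> W t < W s.
Proof.
move=> tc.
move=> /(rewrite_weight (fun g : lifted F => height_weight (height g)) match_vars).
case=> _ [_ [[l [l0 [r [m [[-> ->] lr _ [[p _ lp] _]]]]]] symr wlr]].
have mc : m < c.
  case: r lr symr {wlr} => [x|f a] lr symr; first by case: ncR; exists l0, x.
  by have [q /tc] := symr [::] (f, m.+1) erefl.
have := W_succ (boundR lr) mc lp; rewrite -(ltn_add2l (W s)); move: wlr.
by move=> /leq_ltn_trans h /h; rewrite ltn_add2r.
Qed.

Lemma ground_rel_rewrite s t : rel_rewrite R S s t -> ground s -> ground t.
Proof.
move=> [s' [t' [ss st tt]]] gs; apply: (ground_rewrites trsS tt).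
by apply: (ground_rewrite trsR st); apply: (ground_rewrites trsS ss).
Qed.

Lemma matchRT_step (s : term (lifted F)) t :
  ground s ->
  (forall u, ground u -> matchRT R S c s u ->
     forall p g, symb_at u p = Some g -> height g <= c) ->
  rel_rewrite R S (base s) t ->
  exists s', [/\ matchRT R S c s s', base s' = t & W s' < W s].
Proof.
move=> gs bnd [t1 [t2 [st1 t12 t2t]]].
have gt2 : ground t2.
  apply: (ground_rewrite trsR t12); apply: (ground_rewrites trsS st1).
  by rewrite /ground vars_base.
have lS l r : S (l, r) -> linear_term l by case/linS.
have lR l r : R (l, r) -> linear_term l by case/linR.
have [u1 su1 e1] := rewrites_lifting lS (fun l r => @MATCHRT_lifting _ S c l r trsS) st1.
rewrite -e1 in t12.
have [u2 u12 e2] := rewrite_lifting lR (fun l r => @match_lifting _ R l r trsR) t12.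
rewrite -e2 in t2t.
have [u u2u e] := rewrites_lifting lS (fun l r => @MATCHRT_lifting _ S c l r trsS) t2t.
exists u; split=> //; first by exists u1, u2.
apply: leq_ltn_trans (rewrites_MATCHRT_W u2u) _.
apply: leq_trans (rewrites_MATCHRT_W su1); apply: rewrite_match_W (u12).
(* The term [u2] right after the [R]-step is itself a successor of [s]: the trailing [S]-derivation
   is taken empty. *)
apply: bnd; first by rewrite /ground -vars_base e2.
by exists u1, u2; split=> //; apply: rt_refl.
Qed.

(** Each step loses at least one unit of weight, and the height bound is inherited because
    successors of the next labelled term are successors of [s]. *)
Lemma rel_pow_W m (s : term (lifted F)) t :
  ground s ->
  (forall u, Succ (matchRT R S c) [set s] u ->
     forall p g, symb_at u p = Some g -> height g <= c) ->
  rel_pow (rel_rewrite R S) m (base s) t -> m <= W s.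
Proof.
elim: m s => // m IHm s gs bnd [t1 st1 t1t].
have [|s' [ss' e ws]] := matchRT_step gs _ st1.
  by move=> u gu su; apply: bnd; split=> //; exists s => //; apply: rt_step.
apply: leq_ltn_trans ws; rewrite -e in t1t; apply: IHm t1t => [|u [gu [_ -> su]]].
  rewrite /ground -vars_base e; apply: (ground_rel_rewrite st1).
  by rewrite /ground vars_base.
apply: bnd; split=> //; exists s => //.
by apply: rt_trans su; apply: rt_step.
Qed.

End Bounded.

Theorem theorem5p7 (F : signature) (R S : trs F) (L : set (term F))
    (trsR : is_trs R) (trsS : is_trs S)
    (finR : finite_set R) (finS : finite_set S)
    (linRS : linear_trs (R `|` S))
    (ncR : ~ collapsing R)
    (groundL : forall t, L t -> ground t) :
  matchRT_bounded R S L ->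
  terminating_on (rel_rewrite R S) L /\
  linearly_bounded (fun n => cp n (rel_rewrite R S) L).
Proof.
move=> [c bnd].
have linR : linear_trs R by move=> l r lr; apply: linRS; left.
have linS : linear_trs S by move=> l r lr; apply: linRS; right.
have [B boundB] : exists B, forall rho, (R `|` S) rho -> fsize rho.2 <= B.
  by apply: finite_set_bounded; rewrite finite_setU.
have bR l r (lr : R (l, r)) : fsize r <= B by apply: (boundB (l, r)); left.
have bS l r (lr : S (l, r)) : fsize r <= B by apply: (boundB (l, r)); right.
(* The weight of one symbol of height 0; [lift 0 t] consists of [fsize t] of them. *)
pose K := height_weight c B 0.
have steps t m u : L t -> rel_pow (rel_rewrite R S) m t u -> m <= tsize t * K.
  move=> Lt; rewrite -{1}(liftK 0 t).
  move=> /(rel_pow_W trsR trsS linR linS ncR bR bS) le.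
  apply: (@leq_trans (fsize t * K)); last by rewrite leq_mul2r fsize_le_tsize orbT.
  rewrite -(W_lift c B); apply: le => [|v [gv [_ -> sv]]].
    by rewrite /ground vars_lift; apply: groundL.
  by apply: bnd; split=> //; exists (lift 0 t) => //; exists t.
split=> [t Lt [f [f0 frel]]|].
  (* A prefix one step longer than [steps] allows. *)
  have [u] := rel_pow_prefix (tsize t * K).+1 frel.
  by rewrite f0 => /(steps _ _ _ Lt); rewrite ltnn.
(* [cp] is a supremum of suprema, so the bound is checked at both levels, each time against the
   default 0 as well. *)
exists K, 0 => n _; apply: supremum_le => [|_ [t [Lt tn] <-]]; first by rewrite lee_fin.
apply: supremum_le => [|_ [m [u tu] <-]]; first by rewrite lee_fin.
rewrite lee_fin lez_nat mulnC; apply: leq_trans (steps _ _ _ Lt tu) _.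
by rewrite leq_mul2r tn orbT.
Qed.
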